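(* Let $H=-\sum_{a=1}^M G_a$ be a local frustration-free stabilizer Hamiltonian on the $D$-dimensional periodic lattice $\Lambda=\mathbb{Z}_L^D$ which obeys both topological order conditions with length scale $L_{tqo}\ge L^\beta$ (where $\beta>0$ is a constant) and obeys the no-strings rule with constant $\alpha\ge 1$. There are constants $\gamma>1$ and $c>0$, independent of $L$, $r$, $R$ and of $E,S,S'$ below, such that the following holds. Let $E$ be a Pauli operator creating (from the vacuum) $S$, a neutral cluster of defects containing a charged cluster $S'\subseteq S$ of diameter $r$ such that there are no other defects (of $S$) within distance $R$ from $S'$. If $r+2R<L_{tqo}$, then the weight of $E$ (the number of qubits on which $E$ acts non-trivially) is at least $cR^\gamma$.
   Context: **Lattice.** $\Lambda=\mathbb{Z}_L^D$ is the cubic lattice of linear size $L$ with periodic boundary conditions, with a finite number of qubits at each site; distances and diameters use the $\ell_\infty$ metric. An axis-parallel cube of linear size $\ell$ is a product of $D$ intervals of $\ell$ consecutive coordinates (so $\Lambda$ has linear size $L$). An elementary cube is a unit cell of the lattice (its $2^D$ vertices); it has diameter $1$. $\mathcal{B}_r(A)$ is the set of all points at distance at most $r$ from $A$. ''Constant'' means uniform over the family of Hamiltonians with fixed $D,\alpha,\beta$ as $L$ varies. **Stabilizer Hamiltonian.** $H=-\sum_{a=1}^M G_a$, where the $G_a$ are pairwise commuting multi-qubit Pauli operators (tensor products of $I,X,Y,Z$ with sign $\pm1$), $G_a^2=I$, each acting non-trivially only on qubits at the vertices of one elementary cube (several generators per cube are allowed). No translation invariance is assumed. $\mathcal{G}=\langle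 G_1,\dots,G_M\rangle$ is the stabilizer group; its elements are stabilizers. Frustration-freeness: $-I\notin\mathcal{G}$, so ground states (the ''vacuum'') $\psi_0$ satisfy $G_a\psi_0=\psi_0$ for all $a$. The support of a Pauli operator is the set of sites/qubits on which it acts non-trivially. For a Pauli operator $E$, the defects of $E\psi_0$ (created by applying $E$ to the vacuum) are the generators $G_a$ anticommuting with $E$; each defect is located at the elementary cube of its generator. **Topological order (length scale $L_{tqo}$).** (1) If a Pauli operator $E$ creates no defects when applied to the vacuum and its support can be enclosed by a cube of linear size $L_{tqo}$, then $E$ is a stabilizer. (2) A cluster (set) of defects $S$ is *neutral* if it can be created from the vacuum, without any other defects, by a Pauli operator whose support can be enclosed by a cube of linear size $L_{tqo}$; otherwise $S$ is *charged*. The condition: if $S$ is neutral and $C_{min}(S)$ is the smallest cube enclosing $S$, then $S$ can be created from the vacuum by a Pauli operator supported on $\mathcal{B}_1(C_{min}(S))$. **No-strings rule (constant $\alpha$).** Let $E$ be a Pauli operator whose support can be enclosed by a cube of linear size $L_{tqo}$, let $S$ be the cluster of defects it creates from the vacuum, and let $A_1,A_2$ be disjoint cubes of the same linear size $\rho$. $E$ is a *logical string segment* with anchor regions $A_1,A_2$ iff $S$ is contained in $A_1\cup A_2$ (equivalently $E$ commutes with all generators located outside $A_1\cup A_2$). It has aspect ratio $\alpha'$ iff the distance between $A_1$ and $A_2$ is at least $\alpha'\rho$. It is *trivial* iff the cluster of defects contained inside any anchor region is neutral. The rule: all logical string segments with aspect ratio greater than $\alpha$ are trivial.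
   Formalization: The diameter r of S' is taken as the linear size of the smallest enclosing cube minus 1, not the largest torus distance; they differ only for clusters spread around the torus (L_tqo above about L/2), where the claim with torus distance fails. *)

(* Defs.v *)
(* MathComp + MathComp-Analysis. *)
From HB Require Import structures.
From mathcomp Require Import all_boot all_order all_algebra all_field.
From mathcomp Require Import reals exp.

Set Implicit Arguments.
Unset Strict Implicit.
Unset Printing Implicit Defensive.

Import Order.TTheory GRing.Theory Num.Theory.
Local Open Scope ring_scope.

(** ** The periodic lattice *)

Definition site (D L : nat) : finType := {ffun 'I_D -> 'I_L}.

Section Lattice.
Variables D L : nat.
Implicit Types (x y v : site D L) (A : {set site D L}).

(* Representative in [0, L) of i - j modulo L; 'Z_L is not used because it is
   not Z/LZ for L <= 1. *)
Definition cyc_sub (i j : 'I_L) : nat := ((i + L - j) %% L)%N.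

Definition dist x y : nat :=
  (\max_(i < D) minn (cyc_sub (x i) (y i)) (cyc_sub (y i) (x i)))%N.

(* The l consecutive coordinates v i, v i + 1, ..., v i + l - 1 modulo L in
   each direction i; this is the whole lattice as soon as L <= l. *)
Definition cube v (l : nat) : {set site D L} :=
  [set x : site D L | [forall i : 'I_D, (cyc_sub (x i) (v i) < l)%N]].

Definition ball (r : nat) A : {set site D L} :=
  [set y : site D L | [exists x in A, (dist x y <= r)%N]].

Definition enclosable A (l : nat) : Prop :=
  exists v, A \subset cube v l.

(* A smallest enclosing cube need not be unique: only its linear size is. *)
Definition smallest_cube A v (l : nat) : Prop :=
  A \subset cube v l /\ forall l' : nat, enclosable A l' -> (l <= l')%N.

(* l_oo diameter, read off the smallest enclosing cube: a cube of r + 1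
   consecutive coordinates has diameter r (in particular an elementary cube has
   diameter 1).  It agrees with the largest distance between two points, except
   possibly for sets that spread around the torus: three equidistant points on
   a circle of length L have mutual distance L / 3, but only fit in an interval
   of length 2 L / 3. *)
Definition has_diameter A (r : nat) : Prop :=
  exists v, smallest_cube A v r.+1.

End Lattice.

(** ** Pauli operators *)

Variant pauli1 := PI | PX | PY | PZ.

Definition nontrivial1 (p : pauli1) : bool := if p is PI then false else true.

(* Matrix entry <s| p |t> in the computational basis.  All entries of Pauli
   operators lie in {0, 1, -1, i, -i}, so algebraic numbers suffice. *)
Definition pauli1_entry (p : pauli1) (s t : bool) : algC :=
  match p with
  | PI => (s == t)%:R
  | PX => (s != t)%:R
  | PY => if s == t then 0 else if s then 'i else - 'i
  | PZ => if s == t then (-1) ^+ s else 0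
  end.

Section Pauli.
Variable Q : finType.

Record pauli := Pauli { pauli_sign : bool; pauli_letter : {ffun Q -> pauli1} }.

Definition pauli_qubits (E : pauli) : {set Q} :=
  [set q | nontrivial1 (pauli_letter E q)].

Definition weight (E : pauli) : nat := #|pauli_qubits E|.

(* The Hilbert space has the orthonormal basis {ffun Q -> bool}. *)
Definition operator := 'M[algC]_#|{: {ffun Q -> bool}}|.

Definition basis_state (i : 'I_#|{: {ffun Q -> bool}}|) : {ffun Q -> bool} :=
  enum_val i.

Definition pauli_op (E : pauli) : operator :=
  (-1) ^+ pauli_sign E *:
  \matrix_(i, j) \prod_(q : Q)
     pauli1_entry (pauli_letter E q) (basis_state i q) (basis_state j q).

Definition commutes (E F : pauli) : bool :=
  pauli_op E *m pauli_op F == pauli_op F *m pauli_op E.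

Definition anticommutes (E F : pauli) : bool :=
  pauli_op E *m pauli_op F == - (pauli_op F *m pauli_op E).

End Pauli.

(** ** Stabilizer Hamiltonians *)

(* H = - \sum_a gen a is recorded through its terms.  The number of qubits may
   vary from site to site.  A generator of small support may fit in several
   elementary cubes, hence its location gen_loc is part of the data (the cube
   being designated by its corner of lowest coordinates).  Every signed Pauli
   operator squares to the identity, so that the group spanned by the
   generators is the set of their finite products. *)
Record stabilizer_hamiltonian (D L : nat) := StabilizerHamiltonian {
  qubit : finType;
  qubit_site : qubit -> site D L;
  nb_gen : nat;
  gen : 'I_nb_gen -> pauli qubit;
  gen_loc : 'I_nb_gen -> site D L;
  gen_local : forall a,
    qubit_site @: pauli_qubits (gen a) \subset cube (gen_loc a) 2;
  gen_commute : forall a b, commutes (gen a) (gen b);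
  frustration_free : forall s : seq 'I_nb_gen,
    \big[@mulmx _ _ _ _/1%:M]_(a <- s) pauli_op (gen a) != - 1%:M
}.

Section StabilizerHamiltonian.
Variables (D L : nat) (H : stabilizer_hamiltonian D L).
Implicit Types (E : pauli (qubit H)) (S : {set 'I_(nb_gen H)}).

Definition supp E : {set site D L} := @qubit_site D L H @: pauli_qubits E.

Definition in_stabilizer_group (A : operator (qubit H)) : Prop :=
  exists s : seq 'I_(nb_gen H),
    A = \big[@mulmx _ _ _ _/1%:M]_(a <- s) pauli_op (gen a).

(* Membership up to a global sign: E and - E have the same defects, while
   frustration-freeness prevents both from being stabilizers. *)
Definition is_stabilizer E : Prop :=
  exists e : bool, in_stabilizer_group ((-1) ^+ e *: pauli_op E).

(* The defects of E psi_0, for any vacuum psi_0. *)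
Definition defects E : {set 'I_(nb_gen H)} :=
  [set a | anticommutes (gen a) E].

Definition elem_cube (a : 'I_(nb_gen H)) : {set site D L} :=
  cube (gen_loc a) 2.

Definition region S : {set site D L} := \bigcup_(a in S) elem_cube a.

Definition defects_in S (A : {set site D L}) : {set 'I_(nb_gen H)} :=
  [set a in S | elem_cube a \subset A].

Section TopologicalOrder.
Variable Ltqo : nat.

Definition neutral S : Prop :=
  exists E, defects E = S /\ enclosable (supp E) Ltqo.

Definition charged S : Prop := ~ neutral S.

Definition topological_order1 : Prop :=
  forall E, defects E = set0 -> enclosable (supp E) Ltqo -> is_stabilizer E.

(* One smallest enclosing cube of S is enough, so that the condition follows
   from its variant for any rule selecting a smallest cube. *)
Definition topological_order2 : Prop :=
  forall S, neutral S ->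
    exists v (l : nat), smallest_cube (region S) v l /\
      exists E, defects E = S /\ supp E \subset ball 1 (cube v l).

(* Logical string segment whose anchor regions are the cubes of linear size rho
   with corners v1 and v2. *)
Definition string_segment E (v1 v2 : site D L) (rho : nat) : Prop :=
  [/\ enclosable (supp E) Ltqo,
      [disjoint cube v1 rho & cube v2 rho] &
      region (defects E) \subset cube v1 rho :|: cube v2 rho].

Definition has_aspect_ratio (K : realType) (alpha' : K)
    (v1 v2 : site D L) (rho : nat) : Prop :=
  forall x y, x \in cube v1 rho -> y \in cube v2 rho ->
    alpha' * rho%:R <= (dist x y)%:R.

Definition trivial_segment E (v1 v2 : site D L) (rho : nat) : Prop :=
  neutral (defects_in (defects E) (cube v1 rho)) /\
  neutral (defects_in (defects E) (cube v2 rho)).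

Definition no_strings (K : realType) (alpha : K) : Prop :=
  forall E v1 v2 (rho : nat) (alpha' : K),
    string_segment E v1 v2 rho -> alpha < alpha' ->
    has_aspect_ratio alpha' v1 v2 rho -> trivial_segment E v1 v2 rho.

End TopologicalOrder.

(* No defect of S outside S' lies within distance R from S'. *)
Definition isolated (K : realType) S S' (R : K) : Prop :=
  forall a x y, a \in S :\: S' -> x \in elem_cube a -> y \in region S' ->
    R < (dist x y)%:R.

End StabilizerHamiltonian.

(* Main.v *)
(* Let delta be the distance to S' and N the integer part of R.  Cover the part of
   the support with 0 < delta <= N by balls, charge v ^ gamma for a ball of width
   v, and minimise the total charge over all coverings and all operators with the
   same defects as E.  The charge of E itself is at most its weight, and the
   minimum is of order N ^ gamma, because a minimal covering contains a ball of
   width of order N.  Indeed, consider a ball of width w whose neighbourhood of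
   radius of order w contains neither much wider balls nor the boundary of the
   shell, and take the narrowest one.  By minimality the covering near this ball
   costs no more than a single ball, and as gamma is close to 1 the cost is almost
   linear in the width: so some sphere around it, of radius much larger than w,
   meets the support in at most two small spots.  The truncation of the operator to
   the inside of this sphere has all its defects near these spots.  By the
   no-strings rule if they are far apart, and by the topological order condition
   otherwise, these defects can be created by operators of size O(w), which is
   cheaper than the truncation.  Hence there is no such ball, each ball is the
   start of a chain of wider and wider balls that leads to the boundary of the
   shell, and if all the widths were small compared with N, then the support would
   avoid the middle of the shell and S' would be neutral. *)
Require Import Defs.
From mathcomp Require Import all_boot all_order all_algebra all_field.
From mathcomp Require Import reals exp.
From mathcomp Require Import boolp zify ring lra.

Set Implicit Arguments.
Unset Strict Implicit.
Unset Printing Implicit Defensive.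

Import Order.TTheory GRing.Theory Num.Theory.

(** * Coverings of minimal cost in a metric space *)

Lemma sum_interval_leq lo hi u v :
  \sum_(lo <= r < hi) ((u <= r) && (r <= v) : nat) <= v.+1 - u.
Proof.
suff: \sum_(lo <= r < hi) ((u <= r) && (r <= v) : nat) <= minn hi v.+1 - u.
  by move/leq_trans; apply; lia.
elim: hi => [|hi IH]; first by rewrite big_geq.
have [h|h] := leqP lo hi; last by rewrite big_geq.
rewrite big_nat_recr //=; lia.
Qed.

(** Layers with [e r = 0] contribute at least [k] to the first sum; each other layer has [e r >= 1]
    and is paid for by the second. *)
Lemma layer_count lo hi (f e : nat -> nat) k :
  (forall r, lo <= r < hi -> e r = 0 -> k <= f r) ->
  k * (hi - lo) <= \sum_(lo <= r < hi) f r + k * \sum_(lo <= r < hi) e r.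
Proof.
move=> H; rewrite big_distrr /= -big_split /= mulnC -sum_nat_const_nat.
rewrite !big_nat; apply: leq_sum => r /H.
by case: (e r) => [/(_ erefl)|n _]; [rewrite muln0 addn0|rewrite mulnS; lia].
Qed.

Section Content.
Variables (K : realFieldType) (X : finType) (d : X -> X -> nat).
Variables (delta : X -> nat) (N : nat) (g : nat -> K).
Variable P : {set X} -> Prop.

(** Bounding the radius by [N] makes the type of balls finite, so that a covering of minimal cost
    exists. *)
Definition cball : finType := (X * 'I_N.+1)%type.
Definition center (b : cball) : X := b.1.
Definition radius (b : cball) : nat := b.2.
Definition width (b : cball) : nat := (2 * radius b).+1.
Implicit Types (b : cball) (c : {set cball}) (A : {set X}).

Definition covers c A : Prop :=
  forall x, x \in A -> 0 < delta x -> delta x <= N ->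
    exists2 b, b \in c & d (center b) x <= radius b.

Definition admissible c : Prop := exists2 A, P A & covers c A.

(** With [g v] the power of [v] of exponent gamma - 1, each ball is charged v ^ gamma; the linear
    factor is split off from the slowly varying one. *)
Definition cost c : K := (\sum_(b in c) (width b)%:R * g (width b))%R.

(* A ball is bad if the boundary of the shell, or a much wider ball, is close to
   it in units of its own width.  Following wider and wider balls, a geometric
   series bounds the distance from a bad ball to the end of the chain. *)
Definition bad M c b : bool :=
  [|| delta (center b) <= M * width b, N <= delta (center b) + M * width b
    | [exists b' in c, (4 * width b <= width b') &&
                       (d (center b) (center b') <= M * width b + radius b')]].

(** By the triangle inequality, this holds whenever the sphere of radius [r] around [q] meets the
    ball [b] thickened by [t]. *)
Definition hit q t b r : bool :=
  (d q (center b) - (radius b + t) <= r) &&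
  (r <= d q (center b) + (radius b + t)).

Hypotheses (d0 : forall x, d x x = 0) (dC : forall x y, d x y = d y x).
Hypothesis dT : forall x y z, d x z <= d x y + d y z.
Hypothesis deltaT : forall x y, delta x <= delta y + d x y.

Lemma sum_hits (c : {set cball}) q t lo hi :
  \sum_(lo <= r < hi) #|[set b in c | hit q t b r]|
    <= \sum_(b in c) (width b + 2 * t).
Proof.
under eq_bigr => r _.
  rewrite -sum1_card big_mkcond /=.
  under eq_bigr => b _ do rewrite inE.
  over.
rewrite exchange_big /= [leqRHS]big_mkcond /=; apply: leq_sum => b _.
case: (b \in c) => /=; last by rewrite big1.
have := @sum_interval_leq lo hi (d q (center b) - (radius b + t))
  (d q (center b) + (radius b + t)).
rewrite (eq_bigr (fun r => if hit q t b r then 1 else 0)) => [|r _]; last first.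
  by rewrite /hit; case: ifP.
by move/leq_trans; apply; rewrite /width; lia.
Qed.

(** Induction towards larger widths. The term [M.+1 * width b] is a potential: widths grow by a
    factor 4 along the chain, so its increase pays for each step. *)
Lemma chain_to_boundary M c wm :
  (forall b, b \in c -> bad M c b) -> (forall b, b \in c -> width b <= wm) ->
  forall b, b \in c ->
    delta (center b) + M.+1 * width b <= 2 * M.+1 * wm \/
    N + M.+1 * width b <= delta (center b) + 2 * M.+1 * wm.
Proof.
move=> Hbad Hwm b; move: {2}(wm - width b) (leqnn (wm - width b)) => n.
elim: n b => [|n IH] b hn bc.
all: have wb := Hwm _ bc; have w0 : 0 < width b by [].
all: have Mw : M * width b <= M * wm by rewrite leq_mul2l wb orbT.
all: case/or3P: (Hbad _ bc) => [h|h|].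
1,4: by left; lia.
1,3: by right; lia.
all: case/existsP => b' /andP[b'c /andP[hw hd]].
all: have wb' := Hwm _ b'c.
  by lia.
have Mw' : M * (4 * width b) <= M * width b' by rewrite leq_mul2l hw orbT.
have h' : radius b' * 2 < width b' by rewrite /width; lia.
have h1 := deltaT (center b) (center b'); have := deltaT (center b') (center b); rewrite dC => h2.
have : wm - width b' <= n by lia.
by case/IH => // h; [left|right]; lia.
Qed.

Lemma all_bad_large M c :
  2 < N -> admissible c -> (forall b, b \in c -> bad M c b) ->
  (forall A r, P A -> 0 < r -> r.+1 < N ->
     exists2 x, x \in A & (delta x == r) || (delta x == r.+1)) ->
  exists2 b, b \in c & N <= (4 * M + 9) * width b.
Proof.
move=> N3 [A PA cA] Hbad gap; apply: contrapT => Hn.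
have Hs b : b \in c -> (4 * M + 9) * width b < N.
  by move=> bc; rewrite ltnNge; apply/negP => h; apply: Hn; exists b.
pose wm := \max_(b in c) width b.
have Hwm b : b \in c -> width b <= wm by move=> bc; apply: leq_bigmax_cond.
have hwm : (4 * M + 9) * wm < N.
  have [c0|[b bc]] := set_0Vmem c; first by rewrite /wm c0 big_set0; lia.
  have /(eq_bigmax_cond width) : 0 < #|c| by apply/card_gt0P; exists b.
  by rewrite /wm => -[b' /Hs hb' ->].
(* Centres lie within [2 * M.+1 * wm] of an end of the shell, so no ball reaches the two levels just
   above [(2 * M + 3) * wm]. *)
have g0 : ((2 * M + 3) * wm).+2 < N by lia.
have [//|x xA hx] := gap A ((2 * M + 3) * wm).+1 PA _ g0.
have dx0 : 0 < delta x by lia.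
have dxN : delta x <= N by lia.
have [b bc hb] := cA x xA dx0 dxN.
have := Hwm _ bc; have wb : width b = (2 * radius b).+1 by [].
have h1 := deltaT (center b) x; have := deltaT x (center b); rewrite dC => h2 h3.
have := chain_to_boundary Hbad Hwm bc; lia.
Qed.

(** The chain starts near [q], which is farther than [M * w] from both ends of the shell, so it must
    reach width [w / Lam] before the boundary. Distances are multiplied by [Lam] to avoid
    division. *)
Lemma chain_to_large m M Lam c q w :
  M = 2 * m -> 3 <= m -> 2 * M.+1 <= Lam ->
  M * w < delta q -> delta q + M * w < N ->
  (forall b, b \in c -> width b < w -> bad M c b) ->
  forall b, b \in c -> width b * Lam < w ->
  d q (center b) <= m.+1 * w + 2 * M.+1 * width b ->
  exists2 b', b' \in c &
    w <= width b' * Lam /\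
    Lam * d (center b) (center b') + M.+1 * Lam * width b <= Lam * radius b' + 2 * M.+1 * w.
Proof.
move=> eM m3 hL hq1 hq2 Hbad b.
move: {2}(w - width b) (leqnn (w - width b)) => n; elim: n b => [|n IH] b hn bc wb hd.
  have : width b <= width b * Lam by rewrite leq_pmulr //; lia.
  by lia.
have hwb : 2 * M.+1 * width b <= w.
  by apply: leq_trans (ltnW wb); rewrite mulnC leq_mul2l hL orbT.
have h1 := deltaT q (center b); have := deltaT (center b) q; rewrite dC => h2.
have Mwb : M * width b <= w by lia.
have hmw : 3 * w <= m * w by rewrite leq_mul2r m3 orbT.
have hMw : M * w = 2 * (m * w) by rewrite eM; lia.
have hbw : width b < w.
  by apply: leq_ltn_trans wb; rewrite leq_pmulr //; lia.
case/or3P: (Hbad _ bc hbw) => [h|h|].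
- by lia.
- by lia.
case/existsP => b' /andP[b'c /andP[hw hd']].
have h' : radius b' * 2 < width b' by rewrite /width; lia.
have Mw' : M * (4 * width b) <= M * width b' by rewrite leq_mul2l hw orbT.
have key : d (center b) (center b') + M.+1 * width b + radius b' <= M.+1 * width b' + radius b'.
  by lia.
have [hb'|hb'] := leqP w (width b' * Lam).
  exists b' => //; split => //.
  have : Lam * (d (center b) (center b')) <= Lam * (M * width b + radius b').
    by rewrite leq_mul2l hd' orbT.
  have : (2 * M.+1) * (width b * Lam) <= (2 * M.+1) * w by rewrite leq_mul2l (ltnW wb) orbT.
  by lia.
have [||||b'' b''c [hw'' hd'']] := IH b' => //.
- by have : 0 < width b by []; lia.
- have := dT q (center b) (center b'); lia.
exists b'' => //; split => //.
have : Lam * (d (center b) (center b') + M.+1 * width b) <=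
       Lam * (M.+1 * width b') by rewrite leq_mul2l; lia.
have : Lam * d (center b) (center b'') <=
       Lam * (d (center b) (center b') + d (center b') (center b'')).
  by rewrite leq_mul2l dT orbT.
by lia.
Qed.

Lemma costU c1 c2 : (forall w, 0 <= g w)%R -> (cost (c1 :|: c2) <= cost c1 + cost c2)%R.
Proof.
move=> g0; rewrite /cost (big_setID c1) /= setUK lerD2l setDUl setDv set0U.
rewrite [leRHS](big_setID (c2 :\: c1)) /=.
rewrite (setIidPr _) ?subsetDl // lerDl; apply: sumr_ge0 => b _.
by rewrite mulr_ge0.
Qed.


Hypothesis g_gt0 : forall w, 0 < w -> (0 < g w)%R.
Hypothesis g_ge0 : forall w, (0 <= g w)%R.
Hypothesis g_mono : forall u v, u <= v -> (g u <= g v)%R.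

Lemma cost_mono (c1 c2 : {set cball}) : c1 \subset c2 -> (cost c1 <= cost c2)%R.
Proof.
move=> s12; rewrite /cost [leRHS](big_setID c1) /= (setIidPr s12) lerDl.
by apply: sumr_ge0 => b _; rewrite mulr_ge0.
Qed.

Lemma cost_replace c (D c2 : {set cball}) :
  (forall c', admissible c' -> (cost c <= cost c')%R) -> D \subset c ->
  admissible ((c :\: D) :|: c2) -> (cost D <= cost c2)%R.
Proof.
move=> cmin sD /cmin; have := costU (c :\: D) c2 g_ge0.
have -> : cost c = (cost D + cost (c :\: D))%R.
  by rewrite /cost (big_setID D) /= (setIidPr sD).
lra.
Qed.

Lemma subset_pair (T : finType) (x0 : T) (S : {set T}) :
  #|S| <= 2 -> exists p1 p2, S \subset [set p1; p2].
Proof.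
move=> hS; case: (set_0Vmem S) => [->|[p1 p1S]].
  by exists x0, x0; rewrite sub0set.
case: (set_0Vmem (S :\ p1)) => [S0|[p2 p2S]].
  exists p1, p1; apply/subsetP => x xS; rewrite !inE orbb.
  by have := in_set0 x; rewrite -S0 !inE xS andbT => /negbFE.
exists p1, p2; apply/subsetP => x xS; rewrite !inE.
case: eqP => //= /eqP xp1; case: eqP => // /eqP xp2.
have := cardsD1 p1 S; have := cardsD1 p2 (S :\ p1).
have := cardsD1 x (S :\ p1 :\ p2).
by rewrite p1S p2S !inE xp1 xp2 xS /=; lia.
Qed.

(* [g_slow] says that [v * g v] is almost linear in [v] over the range of scales
   Theta; the slack 21/20 is small enough to tell two crossings of a sphere from
   three. *)
Variables C m0 m M lam I Theta : nat.
(** Around a good ball of width [w], spheres are sought with radius from [m0 * w] to [m * w]; [lam]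
    is the ratio of consecutive scales of width and [I] the number of scales. *)
Hypotheses (C_gt0 : 0 < C) (em0 : m0 = 10 + 16 * C) (em : m = 10 * m0).
Hypotheses (eM : M = 2 * m) (elam : lam = 40 * (2 * M + 3)).
Hypotheses (eI : I = 2 * (4 * M + 7) * (2 * m + 17)).
Hypothesis eTheta : Theta = (2 * m + 17) * lam ^ I.
Hypothesis g_slow :
  forall u v, 0 < u -> v <= Theta * u -> (20%:R * g v <= 21%:R * g u)%R.

(** The two surgeries on supports: erase the inside of a sphere that the support avoids, or replace
    it by two small spots when the support crosses the sphere in two spots. *)
Hypothesis cut0 : forall A q r, P A -> r < delta q -> delta q + r < N ->
  (forall x, x \in A -> d q x <> r) ->
  exists2 A', P A' & forall x, x \in A' -> x \in A /\ r < d q x.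

Hypothesis cut2 : forall A q r a p1 p2, P A -> r < delta q ->
  delta q + r < N -> 0 < a ->
  (forall x, x \in A -> d q x = r -> d p1 x <= a \/ d p2 x <= a) ->
  exists A' z1 z2, P A' /\ forall x, x \in A' ->
    (x \in A /\ r < d q x) \/ d z1 x <= C * a \/ d z2 x <= C * a.

(* A smallest good ball b1 of a covering of minimal cost is contradictory: on
   some sphere around b1, the support lies in two balls of width O(width b1), so
   that [cut2] frees the whole inside of the sphere at a smaller cost. *)
Section GoodBall.
Variables (c : {set cball}) (b1 : cball).
Hypothesis c_adm : admissible c.
Hypothesis c_min : forall c', admissible c' -> (cost c <= cost c')%R.
Hypotheses (b1c : b1 \in c) (b1_good : ~~ bad M c b1).
Hypothesis b1_min : forall b, b \in c -> width b < width b1 -> bad M c b.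

(** The margin [8 * w] makes room for the balls, narrower than [4 * w], that come near a sphere of
    radius at most [m * w]. *)
Variables (q : X) (w rho1 W : nat).
Hypotheses (eq_q : q = (center b1)) (ew : w = width b1).
Hypotheses (erho1 : rho1 = m * w + 8 * w) (eW : W = (2 * rho1).+1).

Let IN := [set b in c | d q (center b) + radius b <= rho1].
Let tall j := [set b in IN | w <= width b * lam ^ j].
Let cls j := tall j.+1 :\: tall j.

Let w_gt0 : 0 < w. Proof. by rewrite ew. Qed.

Let good_low : M * w < delta q.
Proof. by move: b1_good; rewrite eq_q ew /bad !negb_or -!ltnNge => /and3P[]. Qed.

Let good_high : delta q + M * w < N.
Proof. by move: b1_good; rewrite eq_q ew /bad !negb_or -!ltnNge => /and3P[]. Qed.

Let near b : b \in c -> d q (center b) <= M * w + radius b -> width b < 4 * w.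
Proof.
move=> bc; rewrite eq_q ew => hd; move: b1_good; rewrite /bad !negb_or.
move=> /and3P[_ _ /existsPn/(_ b)].
by rewrite bc hd andbT -ltnNge.
Qed.

Let rho1_le : rho1 <= M * w.
Proof.
rewrite erho1 eM -mulnDl leq_mul2r; apply/orP; right; lia.
Qed.

Let W_le : W <= (2 * m + 17) * w.
Proof. by rewrite eW erho1; lia. Qed.

Let mkball z r (hr : r <= N) : cball := (z, Ordinal (hr : r < N.+1)).

Let INc b : b \in IN -> b \in c.
Proof. by rewrite inE => /andP[]. Qed.

(** The single ball of radius [rho1] covers everything that the balls of [IN] cover, so minimality
    compares the two. *)
Let cost_IN : (cost IN <= W%:R * g W)%R.
Proof.
have hr : rho1 <= N by lia.
have -> : (W%:R * g W = cost [set mkball q hr])%R by rewrite /cost big_set1 eW.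
apply: (cost_replace c_min); first by apply/subsetP => b; rewrite inE => /andP[].
have [A PA cA] := c_adm; exists A => // x xA x0 xN.
have [b bc hb] := cA x xA x0 xN.
have [bI|bI] := boolP (b \in IN); last by exists b; rewrite // in_setU in_setD bI bc.
exists (mkball q hr); first by rewrite in_setU in_set1 eqxx orbT.
move: bI; rewrite inE => /andP[_ hI]; rewrite /radius /=.
by have := dT q (center b) x; lia.
Qed.

(** Here [W <= Theta * width b], so [g_slow] converts costs into total widths. *)
Let sum_cost (D : {set cball}) :
  (forall b, b \in D -> w <= width b * lam ^ I) ->
  (20%:R * g W * (\sum_(b in D) width b)%:R <= 21%:R * cost D)%R.
Proof.
move=> hD; rewrite natr_sum /cost !mulr_sumr; apply: ler_sum => b /hD hb.
rewrite [leRHS]mulrCA mulrC ler_wpM2l //.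
rewrite g_slow // eTheta; apply: leq_trans W_le _.
by rewrite -mulnA leq_mul2l [lam ^ I * _]mulnC hb orbT.
Qed.

Let sum_width (D : {set cball}) : D \subset IN ->
  (forall b, b \in D -> w <= width b * lam ^ I) ->
  20 * \sum_(b in D) width b <= 21 * W.
Proof.
move=> /cost_mono h1 /sum_cost h2; have g0 : (0 < g W)%R by apply: g_gt0; rewrite eW.
rewrite -(ler_nat K) -(ler_pM2r g0) !natrM.
have := cost_IN; lra.
Qed.

Let lam_gt0 : 0 < lam. Proof. by rewrite elam; lia. Qed.

Let tallW j k : j <= k -> tall j \subset tall k.
Proof.
move=> jk; apply/subsetP => b; rewrite !inE => /andP[-> /= h].
by apply: leq_trans h _; rewrite leq_mul2l leq_pexp2l // orbT.
Qed.

(* Pigeonhole over the scales: balls of width between w / lam ^ i.+1 and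
   w / lam ^ i are negligible.  The narrower ones are bad, and a chain leads from
   them to a ball of [tall i.+1] within distance t, which is small compared with
   the balls of [tall i]. *)
Let exists_cls : exists2 i, i < I & I * \sum_(b in cls i) width b <= 2 * W.
Proof.
apply: contrapT => Hn.
have H i : i < I -> 2 * W < I * \sum_(b in cls i) width b.
  by move=> iI; rewrite ltnNge; apply/negP => h; apply: Hn; exists i.
have S k : k <= I -> k * (2 * W).+1 <= I * \sum_(b in tall k) width b.
  elim: k => [//|k IH] kI; rewrite (big_setID (tall k)) /=.
  rewrite (setIidPr _); last exact: tallW.
  by rewrite mulnDr mulSn addnC leq_add ?IH ?H // ltnW.
have := S I (leqnn I); rewrite leq_mul2l => /orP[/eqP|]; first by rewrite eI; lia.
have := @sum_width (tall I).
have s1 : tall I \subset IN by apply/subsetP => b; rewrite inE => /andP[].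
have h1 b : b \in tall I -> w <= width b * lam ^ I by rewrite inE => /andP[].
by move=> /(_ s1 h1); lia.
Qed.

Section Scale.
Variable i : nat.
Hypotheses (iI : i < I) (clsW : I * \sum_(b in cls i) width b <= 2 * W).

Variables Lam t : nat.
Hypotheses (eLam : Lam = lam ^ i.+1) (et : t = ((2 * M + 3) * w) %/ Lam).
Let hits (D : {set cball}) r := #|[set b in D | hit q t b r]|.

Let Lam_ge : 40 * (2 * M + 3) <= Lam.
Proof. by rewrite -elam eLam expnS leq_pmulr // expn_gt0 lam_gt0. Qed.

Let tLam : t * Lam <= (2 * M + 3) * w.
Proof. by rewrite et leq_trunc_div. Qed.

Let t_le_w : t <= w.
Proof.
have L0 : 0 < Lam by lia.
rewrite -(leq_pmul2r L0); apply: leq_trans tLam _; rewrite mulnC leq_mul2l; lia.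
Qed.

Let tall_t b : b \in tall i -> 40 * t <= width b.
Proof.
rewrite inE => /andP[_ hb].
have h0 : 0 < (2 * M + 3) * lam ^ i by rewrite muln_gt0 expn_gt0 lam_gt0 addnC.
rewrite -(leq_pmul2r h0).
have : t * Lam <= (2 * M + 3) * (width b * lam ^ i).
  by apply: leq_trans tLam _; rewrite leq_mul2l hb orbT.
rewrite eLam expnS {1}elam; lia.
Qed.

Let cls_t b : b \in tall i.+1 -> t <= (2 * M + 3) * width b.
Proof.
rewrite inE -eLam => /andP[_ hb]; have L0 : 0 < Lam by lia.
rewrite -(leq_pmul2r L0); apply: leq_trans tLam _.
by rewrite -mulnA leq_mul2l hb orbT.
Qed.

(** By [cls_t], a ball of the class meets at most [(4 * M + 7) * width b] layers; [I] is chosen so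
    that the total is at most [w]. *)
Let hits_cls lo hi : \sum_(lo <= r < hi) hits (cls i) r <= w.
Proof.
apply: leq_trans (sum_hits _ _ _ _ _) _.
have : \sum_(b in cls i) (width b + 2 * t) <= \sum_(b in cls i) (4 * M + 7) * width b.
  by apply: leq_sum => b; rewrite inE => /andP[_ /cls_t]; lia.
rewrite -big_distrr /=; move/leq_trans; apply.
have h0 : 0 < 2 * (2 * m + 17) by lia.
rewrite -(leq_pmul2l h0) mulnA [2 * (2 * m + 17) * _]mulnAC -eI.
by apply: leq_trans clsW _; rewrite -mulnA leq_mul2l W_le.
Qed.

Let hits_tall (D : {set cball}) lo hi : D \subset tall i ->
  20 * \sum_(lo <= r < hi) hits D r <= 21 * \sum_(b in D) width b.
Proof.
move=> /subsetP sD; have : 20 * \sum_(lo <= r < hi) hits D r <=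
    20 * \sum_(b in D) (width b + 2 * t) by rewrite leq_mul2l sum_hits orbT.
move/leq_trans; apply; rewrite !big_distrr /=; apply: leq_sum => b /sD /tall_t.
by lia.
Qed.

(** The ball covering [x] either is wide enough or starts a chain to a wide one, whose distance
    excess is at most [t]. *)
Let layer_cover A x : covers c A -> x \in A -> d q x <= m * w ->
  exists2 b, b \in tall i.+1 & d (center b) x <= radius b + t.
Proof.
move=> cA xA hx.
have m8 : 10 * w <= m * w by rewrite leq_mul2r; apply/orP; right; lia.
have hMw : M * w = 2 * (m * w) by rewrite eM; lia.
have x0 : 0 < delta x by have := deltaT q x; lia.
have xN : delta x <= N by have := deltaT x q; rewrite dC; lia.
have L0 : 0 < Lam by lia.
have fin b : b \in c -> w <= width b * Lam -> d (center b) x <= radius b + t ->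
    exists2 b, b \in tall i.+1 & d (center b) x <= radius b + t.
  move=> bc hb hd; exists b => //.
  have := dT q x (center b); rewrite [d x (center b)]dC => hq.
  have hn := near bc _; have hw' : width b < 4 * w by apply: hn; lia.
  rewrite inE -eLam hb andbT inE bc /= erho1.
  by move: hw'; rewrite /width; lia.
have [b bc hb] := cA x xA x0 xN.
have [hL|hL] := leqP w (width b * Lam); first by apply: fin bc hL _; lia.
have hq : d q (center b) <= m.+1 * w + 2 * M.+1 * width b.
  by have := dT q x (center b); rewrite [d x (center b)]dC /width; lia.
have [|||b' b'c [hw' hd']] := chain_to_large (Lam := Lam) eM _ _ good_low good_high _ bc hL hq.
- by lia.
- by lia.
- by rewrite ew.
apply: fin b'c hw' _; rewrite -leq_subLR et leq_divRL //.
have : Lam * d (center b') x <= Lam * d (center b) (center b') + Lam * d (center b) x.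
  by rewrite -mulnDr leq_mul2l [d (center b) (center b')]dC dT orbT.
have : Lam * d (center b) x <= Lam * radius b by rewrite leq_mul2l hb orbT.
have : Lam * radius b <= Lam * width b by rewrite leq_mul2l /width; lia.
rewrite mulnBl; lia.
Qed.

Let Dmin r : {set cball} := [set b in c | d q (center b) + radius b <= r].

Let Dmin_sub r : Dmin r \subset c.
Proof. by apply/subsetP => b; rewrite inE => /andP[]. Qed.

(** Balls of [Dmin r] cover no point outside the sphere, so they can all be exchanged for [c2]. *)
Let replace_inside A A' r (c2 : {set cball}) : covers c A -> P A' ->
  (forall x, x \in A' -> (x \in A /\ r < d q x) \/
     exists2 b, b \in c2 & d (center b) x <= radius b) ->
  (cost (Dmin r) <= cost c2)%R.
Proof.
move=> cA PA' hA'; apply: (cost_replace c_min) => //.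
exists A' => // x /hA'[[xA hx] x0 xN|[b bc hb] _ _]; last first.
  by exists b; rewrite // in_setU bc orbT.
have [b bc hb] := cA x xA x0 xN; exists b => //.
rewrite in_setU in_setD bc inE bc /= -ltnNge.
by have := dT q (center b) x; case: (_ \in c2); rewrite ?orbT ?orbF //; lia.
Qed.

(** Otherwise [cut0] would empty the inside of the sphere and save the positive cost of [b1]. *)
Let layer_hit r : w <= r -> r <= m * w -> exists2 b, b \in tall i.+1 & hit q t b r.
Proof.
move=> wr rm; apply: contrapT => Hn; have [A PA cA] := c_adm.
have hMw : M * w = 2 * (m * w) by rewrite eM; lia.
have [||x xA|A' PA' hA'] := cut0 (q := q) (r := r) PA.
- by have := good_low; lia.
- by have := good_high; lia.
- move=> hx; have [|b bt hb] := layer_cover cA xA; first by lia.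
  apply: Hn; exists b => //; rewrite /hit.
  by have := dT q x (center b); have := dT q (center b) x; rewrite [d x (center b)]dC; lia.
have := @replace_inside A A' r set0 cA PA'.
rewrite {2}/cost big_set0 leNgt => /(_ _)/negP; apply; first by move=> x /hA'; left.
rewrite /cost (bigD1 b1) /=; last first.
  by rewrite inE b1c eq_q d0 add0n; apply: leq_trans wr; rewrite ew /width; lia.
rewrite ltr_wpDr //; first by apply: sumr_ge0 => b _; rewrite mulr_ge0.
by rewrite mulr_gt0 ?g_gt0 // ltr0n.
Qed.

Lemma good_ball_absurd_at_scale : False.
Proof.
(* Balls inside the sphere of radius m0 * w that must be paid for, since a layer
   that no ball hits could be cut for free. *)
pose D := [set b in tall i | d q (center b) + radius b <= m0 * w].
have sD : D \subset tall i by apply/subsetP => b; rewrite inE => /andP[].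
have IN_near b : b \in IN -> width b < 4 * w.
  by rewrite inE => /andP[bc hb]; apply: near => //; have := rho1_le; lia.
have lowD : 20 * ((m0 - 10) * w) <= 21 * \sum_(b in D) width b.
  (* A ball of [IN] hit at radius at most [(m0 - 8) * w] ends before [m0 * w]. Of the layers from
     [w] on, at most [w] are lost to [cls i]. *)
  apply: leq_trans (hits_tall w ((m0 - 8) * w) sD); rewrite leq_mul2l /=.
  have hD r : w <= r < (m0 - 8) * w -> hits (cls i) r = 0 -> 1 <= hits D r.
    move=> /andP[wr rm] /eqP; rewrite cards_eq0 => /eqP Z0; apply/card_gt0P.
    have h8 : (m0 - 8) * w + 8 * w = m0 * w by rewrite -mulnDl; congr (_ * _); lia.
    have [|b bt bh] := layer_hit wr.
      by rewrite em; lia.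
    exists b; rewrite inE bh andbT inE.
    have -> : b \in tall i.
      apply: contraT => nb; have := in_set0 b; rewrite -Z0 inE bh in_setD nb bt.
      by [].
    have /IN_near : b \in IN by move: bt; rewrite inE => /andP[].
    by move: bh; rewrite /hit /width; lia.
  have := layer_count hD; have := hits_cls w ((m0 - 8) * w).
  have : (m0 - 8) * w = (m0 - 10) * w + 2 * w by rewrite -mulnDl; congr (_ * _); lia.
  lia.
(* Three hits on every layer would cost about 3 m w, against the single ball of
   width 2 m w that covers them all. *)
have [r [rlo rhi rcls rtall]] : exists r, [/\ m0 * w <= r, r < m * w,
    hits (cls i) r = 0 & hits (tall i) r <= 2].
  apply: contrapT => Hn.
  have h3 r : m0 * w <= r < m * w -> hits (cls i) r = 0 -> 3 <= hits (tall i) r.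
    move=> /andP[r1 r2] r3.
    by rewrite ltnNge; apply/negP => r4; apply: Hn; exists r.
  have := layer_count h3; have := hits_cls (m0 * w) (m * w).
  have := hits_tall (m0 * w) (m * w) (subxx (tall i)).
  have : 20 * \sum_(b in tall i) width b <= 21 * W.
    apply: sum_width; first by apply/subsetP => b; rewrite inE => /andP[].
    move=> b /(subsetP (tallW (ltnW iI))); rewrite inE => /andP[_ //].
  have : m * w = 10 * (m0 * w) by rewrite em; lia.
  have : 10 * w <= m0 * w by rewrite leq_mul2r; apply/orP; right; lia.
  by have := W_le; lia.
have [A PA cA] := c_adm.
have hMw : M * w = 2 * (m * w) by rewrite eM; lia.
have [p1 [p2 /subsetP hp]] := subset_pair b1 rtall.
(* The spots have size [3 * w]: a radius below [2 * w], plus [t <= w]. *)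
have [|||x xA hx|A' [z1 [z2 [PA' hA']]]] := @cut2 A q r (3 * w) (center p1) (center p2) PA.
- by have := good_low; lia.
- by have := good_high; lia.
- by lia.
- have [|b bt hb] := layer_cover cA xA; first by lia.
  have bh : hit q t b r.
    have := dT q x (center b); have := dT q (center b) x.
    by rewrite /hit [d x (center b)]dC; lia.
  have /hp : b \in [set b in tall i | hit q t b r].
    rewrite inE bh andbT; apply: contraT => nb.
    move/eqP: rcls; rewrite cards_eq0 => /eqP/setP/(_ b).
    by rewrite in_set0 inE bh in_setD nb bt.
  have hb' : d (center b) x <= 3 * w.
    have /IN_near : b \in IN by move: bt; rewrite inE => /andP[].
    by rewrite /width; lia.
  by rewrite !inE => /orP[]/eqP <-; [left|right].
have Cm : 30 * C <= m by lia.
have hC : C * (3 * w) <= N.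
  have : 30 * C * w <= m * w by rewrite leq_mul2r Cm orbT.
  by have := good_high; lia.
have hA2 x : x \in A' -> (x \in A /\ r < d q x) \/
    exists2 b, b \in [set mkball z1 hC; mkball z2 hC] & d (center b) x <= radius b.
  move=> /hA'[|[]] h; [by left|right; exists (mkball z1 hC)|right; exists (mkball z2 hC)] => //.
  - by rewrite !inE eqxx.
  - by rewrite !inE eqxx orbT.
have := replace_inside cA PA' hA2; apply/negP; rewrite -ltNge.
apply: le_lt_trans (costU _ _ g_ge0) _; rewrite /cost !big_set1 -!/(cost _).
have hO z : width (mkball z hC) = (6 * (C * w)).+1 by rewrite /width /radius /=; lia.
rewrite !hO.
(* The new balls cost at most [14 * C * w * g W] together, while [D] costs at least (20/21)^2 times
   [16 * C * w * g W], where [16 * C = m0 - 10]. *)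
have gW : (g (6 * (C * w)).+1 <= g W)%R.
  apply: g_mono; have : 30 * C * w <= m * w by rewrite leq_mul2r Cm orbT.
  by rewrite eW erho1; lia.
have gW0 : (0 < g W)%R by apply: g_gt0; rewrite eW.
have sDD : D \subset Dmin r.
  apply/subsetP => b; rewrite inE => /andP[bt hb].
  move: bt; rewrite inE => /andP[/INc bc _].
  by rewrite inE bc /=; apply: leq_trans hb rlo.
apply: lt_le_trans (cost_mono sDD).
have Dw b : b \in D -> w <= width b * lam ^ I.
  by move=> /(subsetP sD)/(subsetP (tallW (ltnW iI))); rewrite inE => /andP[_].
have h1 := sum_cost Dw.
have h2n : 20 * (16 * (C * w)) <= 21 * \sum_(b in D) width b.
  by apply: leq_trans lowD; rewrite em0 addKn !mulnA.
have cw0 : 0 < C * w by rewrite muln_gt0 C_gt0.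
have h3n : (6 * (C * w)).+1 <= 7 * (C * w) by move: cw0; clear; lia.
move: h2n h3n cw0 gW h1; move: (\sum_(b in D) _) (cost D) (C * w) => s e u.
rewrite -(ler_nat K) (natrM K 20) (natrM K 16) (natrM K 21) => h2.
rewrite -(ler_nat K) (natrM K 7) -(ltr_nat K) => h3 u0 gW h1.
have h5 : ((6 * u).+1%:R * g (6 * u).+1 <= 7%:R * u%:R * g W)%R by apply: ler_pM.
have h6 := ler_wpM2r (ltW gW0) h2.
have h7 : (0 < u%:R * g W)%R by apply: mulr_gt0.
move: h1 h5 h6 h7; move: (_ * g _.+1)%R => o.
rewrite -!mulrA ![(s%:R * _)%R]mulrC; move: (g W * s%:R)%R (u%:R * g W)%R => y z.
lra.
Qed.

End Scale.

Lemma good_ball_absurd : False.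
Proof. by have [i iI h] := exists_cls; apply: (good_ball_absurd_at_scale iI h erefl erefl). Qed.

End GoodBall.

(** The covering of [A] by its own points costs [#|A|]. A minimal one costs no more and contains a
    wide ball, since its narrowest good ball would be contradictory. *)
Lemma content_lower_bound :
  2 < N ->
  (forall A r, P A -> 0 < r -> r.+1 < N ->
     exists2 x, x \in A & (delta x == r) || (delta x == r.+1)) ->
  g 1 = 1%R ->
  forall A, P A -> exists2 v, N <= (4 * M + 9) * v & (v%:R * g v <= #|A|%:R)%R.
Proof.
move=> N3 gap g1 A PA.
pose cA : {set cball} := [set (x, ord0) | x in A].
have cA_adm : admissible cA.
  exists A => // x xA _ _; exists (x, ord0); last by rewrite d0.
  exact: imset_f.
have costA : (cost cA = #|A|%:R)%R.
  rewrite /cost big_imset /=; last by move=> x y _ _ [].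
  by rewrite -sum1_card natr_sum; apply: eq_bigr => x _; rewrite /width /radius /= g1 mul1r.
have /asboolP cA_b := cA_adm.
case: (@arg_minP _ K _ cA (fun c => `[< admissible c >]) cost cA_b) => c /asboolP c_adm c_min.
have {}c_min c' : admissible c' -> (cost c <= cost c')%R by move/asboolP/c_min.
have [b bc hb] : exists2 b, b \in c & N <= (4 * M + 9) * width b.
  apply: all_bad_large gap => // b bc; apply: contraT => bgood.
  case: (@arg_minnP _ b (fun b => (b \in c) && ~~ bad M c b) width).
    by rewrite bc bgood.
  move=> b1 /andP[b1c b1good] b1min; exfalso.
  apply: (good_ball_absurd c_adm c_min b1c b1good _ erefl erefl erefl erefl) => b' b'c hb'.
  by apply: contraLR hb' => b'good; rewrite -leqNgt b1min // b'c.
exists (width b) => //; rewrite -costA; apply: le_trans (c_min _ cA_adm).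
rewrite /cost (bigD1 b) //= lerDl; apply: sumr_ge0 => b' _.
by rewrite mulr_ge0.
Qed.

End Content.

Local Open Scope ring_scope.

(** * Commutation of Pauli operators *)

Definition anti1 (p q : pauli1) : bool :=
  match p, q with
  | PX, PY | PX, PZ | PY, PX | PY, PZ | PZ, PX | PZ, PY => true
  | _, _ => false
  end.

(* The product of two letters up to a phase, which no commutation relation sees. *)
Definition mul1 (p q : pauli1) : pauli1 :=
  match p, q with
  | PI, r | r, PI => r
  | PX, PX | PY, PY | PZ, PZ => PI
  | PX, PY | PY, PX => PZ
  | PX, PZ | PZ, PX => PY
  | PY, PZ | PZ, PY => PX
  end.

Lemma anti1_mul p q r : anti1 p (mul1 q r) = anti1 p q (+) anti1 p r.
Proof. by case: p q r => [] [] []. Qed.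

Section PauliAlgebra.
Variable Q : finType.
Implicit Types E F : pauli Q.

(** The symplectic form over the two-element field that governs commutation. *)
Definition symp E F : bool :=
  \big[addb/false]_(q : Q) anti1 (pauli_letter E q) (pauli_letter F q).

Definition pauli_mul E F : pauli Q :=
  Pauli false [ffun q => mul1 (pauli_letter E q) (pauli_letter F q)].

Definition pauli_restrict E (B : pred Q) : pauli Q :=
  Pauli false [ffun q => if B q then pauli_letter E q else PI].

Lemma symp_mul E F G : symp E (pauli_mul F G) = symp E F (+) symp E G.
Proof.
by rewrite /symp -big_split; apply: eq_bigr => q _; rewrite ffunE anti1_mul.
Qed.

Lemma pauli1_entry_anti (p q : pauli1) (s t : bool) :
  \sum_(b : bool) pauli1_entry p s b * pauli1_entry q b t
  = (-1) ^+ anti1 p q * \sum_(b : bool) pauli1_entry q s b * pauli1_entry p b t.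
Proof. by rewrite !big_bool; case: p q s t => [] [] [] [] /=; ring. Qed.

Lemma pauli1_entry_sqr (p : pauli1) (s t : bool) :
  \sum_(b : bool) pauli1_entry p s b * pauli1_entry p b t = (s == t)%:R.
Proof.
rewrite !big_bool; case: p s t => [] [] [] /=; rewrite ?mulrN ?mulNr -?expr2 ?sqrCi; ring.
Qed.

Lemma pauli_op_mulE E F i j :
  (pauli_op E *m pauli_op F) i j =
  (-1) ^+ pauli_sign E * (-1) ^+ pauli_sign F *
  \prod_(q : Q) \sum_(b : bool) pauli1_entry (pauli_letter E q) (basis_state i q) b
     * pauli1_entry (pauli_letter F q) b (basis_state j q).
Proof.
rewrite bigA_distr_bigA /= mxE mulr_sumr [RHS](reindex _ (onW_bij _ (@enum_val_bij _))) /=.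
apply: eq_bigr => k _; rewrite !mxE big_split /= /basis_state; ring.
Qed.

Lemma pauli_op_anti E F :
  pauli_op E *m pauli_op F = (-1) ^+ symp E F *: (pauli_op F *m pauli_op E).
Proof.
apply/matrixP => i j; rewrite [RHS]mxE !pauli_op_mulE.
under eq_bigr => q _ do rewrite pauli1_entry_anti.
rewrite big_split /=.
have -> : \prod_(q : Q) (-1) ^+ anti1 (pauli_letter E q) (pauli_letter F q)
    = (-1) ^+ symp E F :> algC.
  by apply: esym; apply: (big_morph (fun b : bool => (-1) ^+ b)) => // a b; rewrite signr_addb.
ring.
Qed.

Lemma pauli_op_sqr E : pauli_op E *m pauli_op E = 1%:M.
Proof.
apply/matrixP => i j; rewrite pauli_op_mulE -expr2 sqrr_sign mul1r mxE.
under eq_bigr => q _ do rewrite pauli1_entry_sqr.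
have [->|ne] := eqVneq i j; first by rewrite big1 // => q _; rewrite eqxx.
have [q hq] : exists q, basis_state i q != basis_state j q.
  apply/existsP; apply: contraNT ne; rewrite negb_exists => /forallP h.
  apply/eqP/enum_val_inj/ffunP => q; apply/eqP; have := h q.
  by rewrite negbK.
by rewrite (bigD1 q) //= (negbTE hq) mul0r.
Qed.

(** Operators that both commute and anticommute have product zero, which is impossible for
    involutions. *)
Lemma anticommutesE E F : anticommutes E F = symp E F.
Proof.
rewrite /anticommutes pauli_op_anti; case: (symp E F).
  by rewrite expr1 scaleN1r eqxx.
rewrite expr0 scale1r; apply/negP => /eqP h.
have FE0 : pauli_op F *m pauli_op E = 0.
  apply/matrixP => i j; rewrite [RHS]mxE; apply/eqP.
  by move/matrixP: h => /(_ i j) /eqP; rewrite [X in _ == X]mxE -addr_eq0 -mulr2n mulrn_eq0.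
have : pauli_op F *m (pauli_op F *m pauli_op E) *m pauli_op E = 1%:M.
  by rewrite mulmxA pauli_op_sqr mul1mx pauli_op_sqr.
rewrite FE0 mulmx0 mul0mx => /matrixP/(_ (enum_rank [ffun=> false]) (enum_rank [ffun=> false])).
by rewrite !mxE eqxx => /eqP; rewrite eq_sym oner_eq0.
Qed.

Lemma pauli_mul_qubits E F :
  pauli_qubits (pauli_mul E F) \subset pauli_qubits E :|: pauli_qubits F.
Proof.
apply/subsetP => q; rewrite !inE /= ffunE.
by case: (pauli_letter E q) (pauli_letter F q) => [] [].
Qed.

End PauliAlgebra.

(** * The periodic lattice *)

Section TorusMetric.
Variables D L : nat.
Implicit Types (x y z v : site D L) (A : {set site D L}).
Local Open Scope nat_scope.

Lemma cyc_subE (i j : 'I_L) : cyc_sub i j = if j <= i then i - j else i + L - j.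
Proof.
have hi := ltn_ord i; have hj := ltn_ord j; rewrite /cyc_sub.
case: leqP => h; last by rewrite modn_small //; lia.
by rewrite -addnBAC // modnDr modn_small //; lia.
Qed.

Lemma dist_leP x y h : reflect
  (forall i, cyc_sub (x i) (y i) <= h \/ cyc_sub (y i) (x i) <= h) (dist x y <= h).
Proof.
rewrite /dist; apply: (iffP (bigmax_leqP _ _ _)) => [H i|H i _]; last by rewrite geq_min; apply/orP.
by have := H i isT; rewrite geq_min => /orP.
Qed.

Lemma distxx x : dist x x = 0.
Proof.
apply/eqP; rewrite -leqn0; apply/dist_leP => i; left.
by rewrite cyc_subE leqnn subnn.
Qed.

Lemma distC x y : dist x y = dist y x.
Proof. by apply: eq_bigr => i _; rewrite minnC. Qed.

Lemma dist_triangle x y z : dist x z <= dist x y + dist y z.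
Proof.
have /dist_leP hxy := leqnn (dist x y); have /dist_leP hyz := leqnn (dist y z).
apply/dist_leP => i; move: (hxy i) (hyz i); rewrite !cyc_subE.
move: (ltn_ord (x i)) (ltn_ord (y i)) (ltn_ord (z i)).
move: (nat_of_ord (x i)) (nat_of_ord (y i)) (nat_of_ord (z i)) => a b c.
by move: (dist x y) (dist y z) => e f; do !case: ifP; lia.
Qed.

Lemma cubeP x v l : reflect (forall i, cyc_sub (x i) (v i) < l) (x \in cube v l).
Proof. by rewrite inE; apply: forallP. Qed.

Lemma dist_cube x y v l : x \in cube v l -> y \in cube v l -> dist x y <= l.-1.
Proof.
move=> /cubeP hx /cubeP hy; apply/dist_leP => i; move: (hx i) (hy i).
rewrite !cyc_subE; move: (ltn_ord (x i)) (ltn_ord (y i)) (ltn_ord (v i)).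
by move: (nat_of_ord (x i)) (nat_of_ord (y i)) (nat_of_ord (v i)) => a b c; do !case: ifP; lia.
Qed.

Lemma dist_corner x v l : x \in cube v l -> dist v x <= l.
Proof. by move=> /cubeP hx; apply/dist_leP => i; right; apply: ltnW. Qed.

Lemma cube_widen v l l' : l <= l' -> cube v l \subset cube v l'.
Proof.
by move=> h; apply/subsetP => x /cubeP hx; apply/cubeP => i; apply: leq_trans h.
Qed.

Lemma corner_cube v l : 0 < l -> v \in cube v l.
Proof. by move=> l0; apply/cubeP => i; rewrite cyc_subE leqnn subnn. Qed.

Lemma cube_thicken v l h : exists v', forall x y,
  x \in cube v l -> dist x y <= h -> y \in cube v' (l + 2 * h).
Proof.
(* The corner is moved back by [h] modulo [L]. The default of [insubd] matters only if the new cube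
   is the whole lattice anyway. *)
exists [ffun i => insubd (v i) (if h <= v i then v i - h else v i + L - h)].
move=> x y /cubeP hx /dist_leP hxy; apply/cubeP => i; rewrite ffunE.
have [hL|hL] := leqP L (l + 2 * h).
  by apply: leq_trans hL; rewrite /cyc_sub ltn_pmod //; apply: leq_ltn_trans (ltn_ord (x i)).
have hv : (if h <= v i then v i - h else v i + L - h) < L.
  by have := ltn_ord (v i); case: ifP; lia.
move: (hx i) (hxy i); rewrite !cyc_subE insubdK //; move: hv.
move: (ltn_ord (x i)) (ltn_ord (y i)) (ltn_ord (v i)).
by move: (nat_of_ord (x i)) (nat_of_ord (y i)) (nat_of_ord (v i)) => a b c; do !case: ifP; lia.
Qed.

Lemma ball_sub_cube p h : exists v, forall x, dist p x <= h -> x \in cube v (2 * h).+1.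
Proof.
have [v hv] := cube_thicken p 1 h; exists v => x; apply: hv.
exact: corner_cube.
Qed.

Lemma dist_to_set A : A != set0 -> exists delta : site D L -> nat,
  (forall x y, y \in A -> delta x <= dist x y) /\
  (forall x, exists2 y, y \in A & delta x = dist x y).
Proof.
move=> /set0Pn[z0 hz]; exists (fun x => dist x [arg min_(y < z0 in A) dist x y]).
split=> [x y yA|x]; first by case: arg_minnP => // z _; apply.
by case: arg_minnP => // z zA _; exists z.
Qed.

End TorusMetric.

(** * Truncation of operators *)

Section Cutting.
Variables (D L : nat) (H : stabilizer_hamiltonian D L).
Implicit Types (E F : pauli (qubit H)) (S : {set 'I_(nb_gen H)}).
Implicit Types (x y z v : site D L) (A B : {set site D L}).
Local Open Scope nat_scope.

Definition site_restrict E B := pauli_restrict E (fun q => qubit_site q \in B).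

Lemma mem_defects E a : (a \in defects E) = symp (gen a) E.
Proof. by rewrite inE anticommutesE. Qed.

Lemma mem_defects_mul E F a :
  (a \in defects (pauli_mul E F)) = (a \in defects E) (+) (a \in defects F).
Proof. by rewrite !mem_defects symp_mul. Qed.

Lemma mem_supp E q : nontrivial1 (pauli_letter E q) -> qubit_site q \in supp E.
Proof. by move=> h; apply: imset_f; rewrite inE. Qed.

Lemma gen_site (a : 'I_(nb_gen H)) q :
  nontrivial1 (pauli_letter (gen a) q) -> @qubit_site D L H q \in elem_cube a.
Proof. by move=> h; apply: (subsetP (gen_local a)); apply: imset_f; rewrite inE. Qed.

Lemma anti1_nontrivial p q : anti1 p q -> nontrivial1 p && nontrivial1 q.
Proof. by case: p q => [] []. Qed.

(** A generator sees only the letters of [E] on its own elementary cube. *)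
Lemma defects_restrict_in E B a :
  (forall x, x \in supp E -> x \in elem_cube a -> x \in B) ->
  (a \in defects (site_restrict E B)) = (a \in defects E).
Proof.
move=> h; rewrite !mem_defects; apply: eq_bigr => q _; rewrite ffunE.
case: ifP => // hq; case: (boolP (anti1 _ (pauli_letter E q))) => [|_]; last first.
  by case: (pauli_letter _ q).
by move=> /anti1_nontrivial/andP[/gen_site h1 /mem_supp h2]; rewrite h in hq.
Qed.

Lemma defects_restrict_out E B a :
  (forall x, x \in supp E -> x \in elem_cube a -> x \notin B) ->
  a \notin defects (site_restrict E B).
Proof.
move=> h; rewrite mem_defects /symp big1 // => q _; rewrite ffunE.
case: ifP => hq; last by case: (pauli_letter _ q).
apply/negP => /anti1_nontrivial/andP[/gen_site h1 /mem_supp h2].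
by have := h _ h2 h1; rewrite hq.
Qed.

Lemma supp_restrict E B : supp (site_restrict E B) \subset supp E :&: B.
Proof.
apply/subsetP => x /imsetP[q]; rewrite inE ffunE => hq ->; rewrite inE.
by case: ifP hq => // hB hq; rewrite mem_supp.
Qed.

Lemma supp_mul E F : supp (pauli_mul E F) \subset supp E :|: supp F.
Proof.
by rewrite /supp -imsetU; apply: imsetS; apply: pauli_mul_qubits.
Qed.

Lemma supp_mul_restrict E B : supp (pauli_mul E (site_restrict E B)) \subset supp E :\: B.
Proof.
apply/subsetP => x /imsetP[q]; rewrite inE !ffunE => hq ->; rewrite inE.
case: ifP hq => [_|hB]; first by case: (pauli_letter E q).
by case h : (pauli_letter E q) => // _; apply: mem_supp; rewrite h.
Qed.

Lemma elem_cube_dist (a : 'I_(nb_gen H)) x y : x \in elem_cube a -> y \in elem_cube a -> dist x y <= 1.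
Proof. exact: dist_cube. Qed.

Lemma loc_elem_cube (a : 'I_(nb_gen H)) : gen_loc a \in elem_cube a.
Proof. exact: corner_cube. Qed.

(* Multiplying by the truncation erases E inside B, and F restores its defects. *)
Lemma replace_op E B F : defects F = defects (site_restrict E B) ->
  defects (pauli_mul (pauli_mul E (site_restrict E B)) F) = defects E /\
  supp (pauli_mul (pauli_mul E (site_restrict E B)) F) \subset (supp E :\: B) :|: supp F.
Proof.
move=> hF; split.
  by apply/setP => a; rewrite 2!mem_defects_mul hF; do 2!case: (a \in _).
by apply: subset_trans (supp_mul _ _) _; apply: setSU; apply: supp_mul_restrict.
Qed.

End Cutting.

(** * Surgery in the shell around the charged cluster *)

Section Shell.
Variables (K : realType) (D L : nat) (H : stabilizer_hamiltonian D L).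
Variables (Ltqo r N : nat) (alpha : K) (S S' : {set 'I_(nb_gen H)}).
Variable delta : site D L -> nat.
Implicit Types (E F : pauli (qubit H)) (T : {set 'I_(nb_gen H)}).
Implicit Types (x y z v : site D L) (A B : {set site D L}).
Local Open Scope nat_scope.

Hypothesis alpha_ge1 : (1 <= alpha)%R.
Hypothesis tqo2 : topological_order2 H Ltqo.
Hypothesis nostr : no_strings H Ltqo alpha.
Hypotheses (sS'S : S' \subset S) (chS' : charged Ltqo S').
Hypothesis diamS' : has_diameter (region S') r.
Hypothesis delta_le : forall x y, y \in region S' -> delta x <= dist x y.
Hypothesis delta_ex : forall x, exists2 y, y \in region S' & delta x = dist x y.
Hypothesis isol : forall a x, a \in S :\: S' -> x \in elem_cube a -> N < delta x.
Hypothesis rN : r + 2 * N <= Ltqo.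

Lemma deltaT x y : delta x <= delta y + dist x y.
Proof.
have [z zS ->] := delta_ex y; apply: leq_trans (delta_le x zS) _.
by rewrite addnC dist_triangle.
Qed.

Lemma delta_region x : x \in region S' -> delta x = 0.
Proof. by move/(delta_le x); rewrite distxx leqn0 => /eqP. Qed.

Lemma delta_in a x : a \in S' -> x \in elem_cube a -> delta x = 0.
Proof. by move=> aS xa; apply: delta_region; apply/bigcupP; exists a. Qed.

Definition dball (q : site D L) k : {set site D L} := [set x | dist q x <= k].

(** An elementary cube has diameter 1, so unless it meets the support on the sphere itself it sees
    the support on one side only. There the truncation agrees with [E], which has no defect in the
    shell, or is trivial. *)
Lemma cut_defect E q k a : defects E = S -> k < delta q -> delta q + k < N ->
  a \in defects (site_restrict E (dball q k)) ->
  exists2 x, x \in supp E & x \in elem_cube a /\ dist q x = k.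
Proof.
move=> ES k1 k2; apply: contraPP => Hn.
have Hne x : x \in supp E -> x \in elem_cube a -> dist q x != k.
  by move=> xE xa; apply/eqP => hx; apply: Hn; exists x.
apply/negP.
have [[x [xE xa xk]]|Hout] := pselect
    (exists x, [/\ x \in supp E, x \in elem_cube a & dist q x <= k]); last first.
  apply: defects_restrict_out => x xE xa; rewrite inE; apply/negP => h.
  by apply: Hout; exists x.
rewrite defects_restrict_in => [|y yE ya]; last first.
  rewrite inE leqNgt; apply/negP => hy.
  have := Hne x xE xa; have := elem_cube_dist xa ya.
  by have := dist_triangle q x y; lia.
rewrite ES; apply/negP => aS.
have h1 := deltaT q x; have h2 := deltaT x q; rewrite distC in h2.
have [aS'|aS'] := boolP (a \in S').
  by have := delta_in aS' xa; lia.
have : a \in S :\: S' by rewrite inE aS' aS.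
by move/isol => /(_ _ xa); lia.
Qed.

Definition defect_support A : Prop := exists2 E, defects E = S & supp E = A.

Lemma cut_empty A q k : defect_support A -> k < delta q -> delta q + k < N ->
  (forall x, x \in A -> dist q x <> k) ->
  exists2 A', defect_support A' & forall x, x \in A' -> x \in A /\ k < dist q x.
Proof.
move=> [E ES <-] k1 k2 hk.
exists (supp (pauli_mul E (site_restrict E (dball q k)))).
  exists (pauli_mul E (site_restrict E (dball q k))) => //.
  apply/setP => a; rewrite mem_defects_mul ES.
  case: (boolP (a \in defects (site_restrict _ _))); rewrite ?addbF // => ha.
  have [x xE [_ hx]] := cut_defect ES k1 k2 ha.
  by have := hk x xE.
by move=> x /(subsetP (supp_mul_restrict _ _)); rewrite !inE -ltnNge => /andP[].
Qed.

Lemma smallest_cube_le A v l v' l' :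
  smallest_cube A v l -> A \subset cube v' l' -> l <= l'.
Proof. by move=> [_ h] hA; apply: h; exists v'. Qed.

(** The second topological order condition bounds the size of the operator by that of the
    cluster. *)
Lemma neutral_local_op T v l : neutral Ltqo T -> region T \subset cube v l ->
  exists F z, defects F = T /\ forall x, x \in supp F -> dist z x <= l.+1.
Proof.
move=> /tqo2[z [l' [hs [F [hF sF]]]]] hT; exists F, z; split => // x /(subsetP sF).
rewrite inE => /existsP[y /andP[/dist_corner hy hx]].
have := smallest_cube_le hs hT; have := dist_triangle z y x.
by lia.
Qed.

Lemma region_sub T A : (forall a, a \in T -> elem_cube a \subset A) -> region T \subset A.
Proof. by move=> h; apply/bigcupsP. Qed.

Lemma cut_two (s0 : nat) A q k a p1 p2 : (alpha + 1 <= s0%:R)%R ->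
  defect_support A -> k < delta q -> delta q + k < N -> 0 < a ->
  (forall x, x \in A -> dist q x = k -> dist p1 x <= a \/ dist p2 x <= a) ->
  exists A' z1 z2, defect_support A' /\ forall x, x \in A' ->
    (x \in A /\ k < dist q x) \/
    dist z1 x <= (10 * s0 + 40) * a \/ dist z2 x <= (10 * s0 + 40) * a.
Proof.
move=> hT0 [E ES <-] k1 k2 a0 hk.
set EB := site_restrict E (dball q k).
suff [F [z1 [z2 [hF sF]]]] : exists F z1 z2, defects F = defects EB /\
    forall x, x \in supp F ->
      dist z1 x <= (10 * s0 + 40) * a \/ dist z2 x <= (10 * s0 + 40) * a.
  have [h1 h2] := replace_op hF.
  exists (supp (pauli_mul (pauli_mul E EB) F)), z1, z2; split.
    by exists (pauli_mul (pauli_mul E EB) F) => //; rewrite h1.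
  move=> x /(subsetP h2); rewrite inE => /orP[|/sF]; last by right.
  by rewrite !inE -ltnNge => /andP[? ?]; left.
(* The hypotheses on [k] give [2 * k < N], so the truncation fits in a cube of size [Ltqo]. *)
have encl : enclosable (supp EB) Ltqo.
  have [v hv] := ball_sub_cube q k; exists v.
  have h : (2 * k).+1 <= Ltqo by lia.
  apply/subsetP => x /(subsetP (supp_restrict _ _))/setIP[_]; rewrite inE => /hv.
  exact: (subsetP (cube_widen v h)).
have nEB : neutral Ltqo (defects EB) by exists EB.
have [v1 hv1] := ball_sub_cube p1 a.+1.
have [v2 hv2] := ball_sub_cube p2 a.+1.
pose rho := (2 * a.+1).+1.
have near b : b \in defects EB ->
    (forall y, y \in elem_cube b -> dist p1 y <= a.+1) \/
    (forall y, y \in elem_cube b -> dist p2 y <= a.+1).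
  move=> /(cut_defect ES k1 k2)[x xE [xb hx]].
  case: (hk x xE hx) => hp; [left|right] => y yb; have := elem_cube_dist xb yb.
    by have := dist_triangle p1 x y; lia.
  by have := dist_triangle p2 x y; lia.
(* Removing the diameters of both cubes leaves a distance [s0 * rho], hence aspect ratio
   [alpha + 1], strictly above [alpha]. *)
have [far|close] := leqP ((s0 + 2) * rho) (dist p1 p2).
- have rho0 : 0 < rho by [].
  have hp1 : p1 \in cube v1 rho by apply: hv1; rewrite distxx.
  have hp2 : p2 \in cube v2 rho by apply: hv2; rewrite distxx.
  have asp x y : x \in cube v1 rho -> y \in cube v2 rho -> s0 * rho <= dist x y.
    move=> hx hy; have := dist_cube hp1 hx; have := dist_cube hy hp2.
    have := dist_triangle p1 x p2; have := dist_triangle x y p2; lia.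
  have T00 : 0 < s0.
    by rewrite -(ltr_nat K); move: alpha_ge1 hT0; lra.
  have disj : [disjoint cube v1 rho & cube v2 rho].
    apply/pred0P => x /=; apply/negP => /andP[hx hy].
    have := asp x x hx hy; rewrite distxx leqNgt muln_gt0 T00 rho0 //.
  have inA b : b \in defects EB ->
      (elem_cube b \subset cube v1 rho) || (elem_cube b \subset cube v2 rho).
    move/near => [h|h]; apply/orP; [left|right]; apply/subsetP => y /h; [exact: hv1|exact: hv2].
  have seg : string_segment Ltqo EB v1 v2 rho.
    split => //; apply: region_sub => b /inA /orP[] h; apply: subset_trans h _.
      exact: subsetUl.
    exact: subsetUr.
  have alpha_lt : (alpha < alpha + 1)%R by rewrite ltrDl ltr01.
  have [|n1 n2] := nostr seg alpha_lt.
    move=> x y hx hy; apply: (@le_trans _ _ (s0%:R * rho%:R)%R).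
      by rewrite ler_wpM2r.
    by rewrite -natrM ler_nat asp.
  have [|F1 [z1 [hF1 sF1]]] := neutral_local_op n1 (v := v1) (l := rho) _.
    by apply: region_sub => b; rewrite inE => /andP[].
  have [|F2 [z2 [hF2 sF2]]] := neutral_local_op n2 (v := v2) (l := rho) _.
    by apply: region_sub => b; rewrite inE => /andP[].
  exists (pauli_mul F1 F2), z1, z2; split.
    apply/setP => b; rewrite mem_defects_mul hF1 hF2 !inE -!andb_addr.
    case: (boolP (anticommutes (gen b) EB)) => // hb.
    have /inA : b \in defects EB by rewrite inE.
    have [c1|_] := boolP (elem_cube b \subset cube v1 rho); last by move=> /= ->.
    have [c2|//] := boolP (elem_cube b \subset cube v2 rho).
    have := disjoint_setI0 disj; move/setP => /(_ (gen_loc b)).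
    by rewrite in_set0 in_setI (subsetP c1) ?(subsetP c2) ?loc_elem_cube.
  move=> x /(subsetP (supp_mul _ _)); rewrite inE => /orP[/sF1|/sF2] hx; [left|right].
    by apply: leq_trans hx _; rewrite /rho; lia.
  by apply: leq_trans hx _; rewrite /rho; lia.
(* One ball around [p1] contains all the defects, which are jointly neutral by [nEB]. *)
- pose R0 := (s0 + 2) * rho + a.+1.
  have [v hv] := ball_sub_cube p1 R0.
  have [|F [z [hF sF]]] := neutral_local_op nEB (v := v) (l := (2 * R0).+1) _.
    apply: region_sub => b /near [h|h]; apply/subsetP => y /h hy; apply: hv; rewrite /R0.
      by lia.
    by have := dist_triangle p1 p2 y; lia.
  exists F, z, z; split => // x /sF hx; left; apply: leq_trans hx _.
  by rewrite /R0 /rho; nia.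
Qed.

(** If both layers were empty, no generator would see the support on both sides. The truncation to
    [delta x <= k] would then create exactly [S'], making it neutral. *)
Lemma no_gap A k : defect_support A -> 0 < k -> k.+1 < N ->
  exists2 x, x \in A & (delta x == k) || (delta x == k.+1).
Proof.
move=> [E ES <-] k0 kN; apply: contrapT => Hn; apply: chS'.
have gapE x : x \in supp E -> delta x <> k /\ delta x <> k.+1.
  by move=> xE; split => h; apply: Hn; exists x => //; rewrite h eqxx ?orbT.
pose B := [set x | delta x <= k].
have side (a : 'I_(nb_gen H)) : (forall x, x \in supp E -> x \in elem_cube a -> x \in B) \/
    (forall x, x \in supp E -> x \in elem_cube a -> x \notin B).
  have [[x [xE xa xB]]|h] :=
      pselect (exists x, [/\ x \in supp E, x \in elem_cube a & x \in B]).
    left=> y yE ya; move: xB; rewrite !inE => xB; rewrite leqNgt; apply/negP => hy.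
    have := gapE x xE; have := gapE y yE; have := elem_cube_dist ya xa.
    by have := deltaT y x; lia.
  by right=> x xE xa; apply/negP => xB; apply: h; exists x.
exists (site_restrict E B); split; last first.
  have [v [hv _]] := diamS'; have [v' hv'] := cube_thicken v r.+1 k; exists v'.
  apply/subsetP => x /(subsetP (supp_restrict _ _))/setIP[_]; rewrite inE => hx.
  have [y yS hy] := delta_ex x.
  have h : r.+1 + 2 * k <= Ltqo by lia.
  apply: (subsetP (cube_widen v' h)).
  by apply: (hv' y); [apply: (subsetP hv)|rewrite distC -hy].
apply/setP => a; have [aS'|aS'] := boolP (a \in S').
  rewrite defects_restrict_in; first by rewrite ES (subsetP sS'S).
  by move=> x _ xa; rewrite inE (delta_in aS' xa).
have [aS|aS] := boolP (a \in S).
  apply/negbTE/defects_restrict_out => x _ xa; rewrite inE -ltnNge.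
  have : a \in S :\: S' by rewrite inE aS' aS.
  by move/isol => /(_ _ xa); lia.
apply/negbTE; case: (side a) => h; last exact: defects_restrict_out.
by rewrite defects_restrict_in // ES.
Qed.

End Shell.


(** * Choice of the exponent and conclusion *)

Lemma exprn_ge_linear (K : realType) (n : nat) :
  1 + n%:R / 20%:R <= (21%:R / 20%:R : K) ^+ n.
Proof.
elim: n => [|n IH]; first by rewrite mul0r addr0 expr0.
rewrite exprS; have h : (0 : K) <= n%:R by [].
apply: (@le_trans _ _ (21%:R / 20%:R * (1 + n%:R / 20%:R))); first by rewrite -natr1; lra.
by rewrite ler_pM2l //; lra.
Qed.

(** By Bernoulli's inequality, [n > 20 * Theta] makes the [n]-th root of [Theta] at most 21/20. *)
Lemma powR_slow (K : realType) (Theta n u v : nat) :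
  n = (20 * Theta).+1 -> (v <= Theta * u)%N ->
  20%:R * (v%:R : K) `^ n%:R^-1 <= 21%:R * u%:R `^ n%:R^-1.
Proof.
move=> en huv; have n0 : (0 : K) < n%:R by rewrite ltr0n en.
have hT : (Theta%:R : K) `^ n%:R^-1 <= 21%:R / 20%:R.
  have h : (Theta%:R : K) <= (21%:R / 20%:R) ^+ n.
    apply: le_trans (exprn_ge_linear _ _); rewrite en -natr1 natrM; lra.
  have -> : (21%:R / 20%:R : K) = ((21%:R / 20%:R) ^+ n) `^ n%:R^-1.
    rewrite -powR_mulrn ?divr_ge0 // -powRrM divff ?powRr1 ?divr_ge0 //.
    by rewrite gt_eqF.
  apply: ge0_ler_powR => //; rewrite ?nnegrE ?invr_ge0 ?exprn_ge0 ?divr_ge0 //.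
have h : (v%:R : K) `^ n%:R^-1 <= Theta%:R `^ n%:R^-1 * u%:R `^ n%:R^-1.
  rewrite -powRM // -natrM; apply: ge0_ler_powR; rewrite ?nnegrE ?invr_ge0 //.
  by rewrite ler_nat.
have := ler_wpM2r (powR_ge0 (u%:R : K) n%:R^-1) hT.
lra.
Qed.

Lemma supp_le_weight D L (H : stabilizer_hamiltonian D L) (E : pauli (qubit H)) :
  (#|supp E| <= weight E)%N.
Proof. exact: leq_imset_card. Qed.

Lemma defects_weight0 D L (H : stabilizer_hamiltonian D L) (E : pauli (qubit H)) :
  weight E = 0 -> defects E = set0.
Proof.
move=> /eqP; rewrite cards_eq0 => /eqP E0; apply/setP => a; rewrite in_set0 mem_defects.
rewrite /symp big1 // => q _; have := in_set0 q; rewrite -E0 inE.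
by case: (pauli_letter E q) (pauli_letter (gen a) q) => [] [].
Qed.

Theorem theorem3 (K : realType) (D : nat) (alpha beta : K)
    (alpha_ge1 : 1 <= alpha) (beta_gt0 : 0 < beta) :
  exists gamma c : K, 1 < gamma /\ 0 < c /\
    forall (L : nat) (H : stabilizer_hamiltonian D L) (Ltqo : nat),
      (0 < L)%N ->
      L%:R `^ beta <= Ltqo%:R ->
      topological_order1 H Ltqo ->
      topological_order2 H Ltqo ->
      no_strings H Ltqo alpha ->
      forall (E : pauli (qubit H)) (S S' : {set 'I_(nb_gen H)})
             (r : nat) (R : K),
        defects E = S ->
        neutral Ltqo S ->
        S' \subset S ->
        charged Ltqo S' ->
        has_diameter (region S') r ->
        0 <= R ->
        isolated S S' R ->
        r%:R + 2 * R < Ltqo%:R ->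
        c * R `^ gamma <= (weight E)%:R.
Proof.
pose s0 := (Num.truncn (alpha + 1)).+1.
have hs0 : alpha + 1 <= s0%:R by apply/ltW/truncnS_gt.
pose C := (10 * s0 + 40)%N.
(* The constants are kept abstract, as lam ^ I must never be computed. *)
have [m0 em0] : exists m0, m0 = (10 + 16 * C)%N by eexists.
have [m em] : exists m, m = (10 * m0)%N by eexists.
have [M eM] : exists M, M = (2 * m)%N by eexists.
have [lam elam] : exists lam, lam = (40 * (2 * M + 3))%N by eexists.
have [I eI] : exists I, I = (2 * (4 * M + 7) * (2 * m + 17))%N by eexists.
have [Theta eTheta] : exists Theta, Theta = ((2 * m + 17) * lam ^ I)%N by eexists.
have [n en] : exists n, n = (20 * Theta).+1 by eexists.
have n0 : (0 : K) < n%:R by rewrite ltr0n en.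
have i0 : (0 : K) < n%:R^-1 by rewrite invr_gt0.
pose gamma : K := 1 + n%:R^-1.
have gamma0 : 0 <= gamma by rewrite addr_ge0 // ltW.
(* The factor 2 absorbs the rounding of [R] down to [N]. *)
pose B : K := (2 * (4 * M + 9))%N%:R.
have B0 : 0 < B by rewrite ltr0n; lia.
exists gamma, (B `^ gamma)^-1; split; first by rewrite /gamma ltrDl.
split; first by rewrite invr_gt0 powR_gt0.
move=> L H Ltqo L0 _ _ tqo2 nostr E S S' r R ES nS sS chS' diam R0 isol rR.
rewrite mulrC ler_pdivrMr ?powR_gt0 //.
pose N := Num.truncn R.
have /andP[NR RN] : N%:R <= R < N.+1%:R by apply: truncn_itv.
(* If the weight were 0, [S'] would be empty like [S], hence neutral. This settles small [R]. *)
have W0 : (0 < weight E)%N.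
  rewrite lt0n; apply/eqP => /defects_weight0 E0; apply: chS'.
  have S0 : S = set0 by rewrite -ES.
  by move: sS; rewrite S0 subset0 => /eqP ->; rewrite -S0.
suff [v hv hw] : exists2 v : nat, R <= B * v%:R & (v%:R : K) `^ gamma <= (weight E)%:R.
  apply: (@le_trans _ _ ((B * v%:R) `^ gamma)).
    by apply: ge0_ler_powR; rewrite ?nnegrE // mulr_ge0 // ltW.
  by rewrite powRM ?(ltW B0) // mulrC ler_wpM2r ?powR_ge0.
have [N3|N3] := leqP N 2.
  exists 1%N; last by rewrite powR1 ler1n.
  rewrite mulr1; apply: le_trans (ltW RN) _; rewrite ler_nat.
  by move: (N) (M) N3 => N' M' N3; clear -N3; lia.
(* An empty region fits in a cube of size 0, whereas a smallest cube for diameter [r] has size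
   [r.+1]. *)
have regS' : region S' != set0.
  apply/eqP => h; have [v [_ hmin]] := diam.
  by have := hmin 0; rewrite h ltn0 => /(_ (ex_intro _ v (sub0set _))).
have [delta [d1 d2]] := dist_to_set regS'.
have isolN (a : 'I_(nb_gen H)) x : a \in S :\: S' -> x \in elem_cube a -> (N < delta x)%N.
  move=> aS xa; have [y yS ->] := d2 x; rewrite -(ltr_nat K).
  by apply: le_lt_trans NR _; apply: isol aS xa yS.
have rN : (r + 2 * N <= Ltqo)%N.
  by rewrite -(ler_nat K) natrD natrM; apply: ltW; apply: le_lt_trans rR; lra.
pose g (v : nat) : K := v%:R `^ n%:R^-1.
have PE : defect_support S (supp E) by exists E.
have CC : (0 < C)%N by rewrite /C addnC.
have g_gt0 u : (0 < u)%N -> 0 < g u by move=> u0; rewrite powR_gt0 ?ltr0n.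
have g_ge0 u : 0 <= g u by apply: powR_ge0.
have g_mono u u' : (u <= u')%N -> g u <= g u'.
  by move=> h; apply: ge0_ler_powR; rewrite ?nnegrE ?(ltW i0) // ler_nat.
have g_slow u u' : (0 < u)%N -> (u' <= Theta * u)%N -> 20%:R * g u' <= 21%:R * g u.
  by move=> _; apply: powR_slow en.
have g1 : g 1%N = 1 by rewrite /g powR1.
have [v hv hw] := content_lower_bound (@distxx D L) (@distC D L) (@dist_triangle D L)
  (deltaT d1 d2) g_gt0 g_ge0 g_mono CC em0 em eM elam eI eTheta g_slow
  (cut_empty alpha_ge1 sS d1 d2 isolN rN)
  (fun A q k a p1 p2 => cut_two alpha_ge1 tqo2 nostr sS d1 d2 isolN rN hs0)
  N3 (no_gap alpha_ge1 sS chS' diam d1 d2 isolN rN) g1 PE.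
have v0 : (0 < v)%N by move: hv N3; case: (v) => //; rewrite muln0 leqn0 => /eqP ->.
exists v.
  apply: le_trans (ltW RN) _; rewrite -natrM ler_nat.
  by move: N3 hv; move: (N) (M) => N' M'; clear; lia.
have -> : v%:R `^ gamma = v%:R * g v :> K.
  by rewrite /gamma powRD ?powRr1 // (gt_eqF (_ : 0 < v%:R)) ?ltr0n // implybT.
by apply: le_trans hw _; rewrite ler_nat supp_le_weight.
Qed.
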